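(* Let the domination property and the ideal point property hold for $P(\mathcal{U})$ and for $P(\mathcal{U}')$ for any finite (nonempty) subset $\mathcal{U}'\subseteq\mathcal{U}$. (i) Let $\mathcal{U}$ be finite. Then multiobjective optimization-pessimization returns a representative set of extreme supported efficient solutions to $P(\mathcal{U})$ in at most $|\mathcal{U}|$ iterations. (ii) Let $\mathcal{U}$ be a polytope or finite and let $f_i(x,\cdot):\mathrm{conv}(\mathcal{U})\to\mathbb{R}$, $x\in\mathcal{X}$, $i=1,\dots,p$, be continuous and quasi-convex. Then multiobjective optimization-pessimization returns a representative set of extreme supported efficient solutions to $P(\mathcal{U})$ in at most $K$ iterations, where $K$ is the number of extreme points of $\mathcal{U}$, provided that an algorithm is chosen for the pessimization problem that always finds an extreme point of $\mathcal{U}$.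
   Context: Orders: for $y,\bar y\in\mathbb{R}^p$, $\le$ is componentwise; $y\preceq\bar y$ ($y$ dominates $\bar y$) means $y\le\bar y$ and $y\ne\bar y$. Problem: $\mathcal{X}\subseteq\mathbb{R}^n$, $\mathcal{U}\subseteq\mathbb{R}^m$, $f_i:\mathcal{X}\times\mathcal{U}\to\mathbb{R}$ for $i=1,\dots,p$. For nonempty $\mathcal{U}'\subseteq\mathcal{U}$ put $f_i^{\mathcal{U}'}(x)=\sup_{\xi\in\mathcal{U}'}f_i(x,\xi)$ (real-valued), $f^{\mathcal{U}'}=(f_1^{\mathcal{U}'},\dots,f_p^{\mathcal{U}'})^t$; $P(\mathcal{U}')$ is the problem $\min_{x\in\mathcal{X}}f^{\mathcal{U}'}(x)$. Solutions of $\min_{x\in\mathcal{X}}g(x)$ with $g:\mathcal{X}\to\mathbb{R}^p$, $\mathcal{Y}=g(\mathcal{X})$: $x\in\mathcal{X}$ is efficient and $g(x)$ nondominated if no $x'\in\mathcal{X}\setminus\{x\}$ has $g(x')\preceq g(x)$; $\mathcal{Y}_{\mathrm N}$ is the set of nondominated points. A point $y\in\mathcal{Y}$ is extreme supported nondominated if there is no convex combination of nondominated points $y^{(1)},\dots,y^{(N)}\in\mathcal{Y}\setminus\{y\}$ with $\sum_i\lambda_iy^{(i)}\le y$; $x$ is extreme supported efficient if $g(x)$ is extreme supported nondominated. A representative set of extreme supported efficient solutions is a subset of $\mathcal{X}$ whose image under $g$ is exactly the set of extreme supported nondominated points. Ideal point property: $\min_{x\in\mathcal{X}}g_i(x)$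 exists for $i=1,\dots,p$. Domination property: for all $y\in\mathcal{Y}\setminus\mathcal{Y}_{\mathrm N}$ there is $y'\in\mathcal{Y}_{\mathrm N}$ with $y'\preceq y$. For finite $\mathcal{U}$, ''extreme points of $\mathcal{U}$'' in (ii) means extreme points of $\mathrm{conv}(\mathcal{U})$. Multiobjective optimization-pessimization: Input $P(\mathcal{U})$ and a finite nonempty initial set $\mathcal{U}^{(0)}\subseteq\mathcal{U}$. Set $k=0$. Repeat: set $\mathcal{U}^{(k+1)}=\mathcal{U}^{(k)}$; (optimization) determine a representative set $X^{(k)\ast}$ of extreme supported efficient solutions and the set $Y^{(k)\ast}$ of extreme supported nondominated points of $P(\mathcal{U}^{(k)})$; (pessimization) for every $x^\ast\in X^{(k)\ast}$ and every $i=1,\dots,p$ determine some $\xi^\ast\in\arg\max_{\xi\in\mathcal{U}}f_i(x^\ast,\xi)$ and add $\xi^\ast$ to $\mathcal{U}^{(k+1)}$; set $k=k+1$; until $f^{\mathcal{U}}(x^\ast)=f^{\mathcal{U}^{(k-1)}}(x^\ast)$ for all $x^\ast\in X^{(k-1)\ast}$. Return $X^{(k-1)\ast}$, $Y^{(k-1)\ast}$. An iteration is one pass of the repeat-loop; the subproblems are assumed to be solved exactly.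
   Formalization: Added: for each finite nonempty U'⊆U, every nondominated point of P(U') is weakly dominated by a convex combination of extreme supported nondominated points of P(U'). In (ii) the bound K is claimed only if U^(0) contains an extreme point of U; otherwise the bound is K+1. *)

(* Defs.v *)
From HB Require Import structures.
From mathcomp Require Import all_boot all_order all_algebra finmap.
From mathcomp Require Import all_classical all_reals topology.

Set Implicit Arguments.
Unset Strict Implicit.
Unset Printing Implicit Defensive.

Import Order.TTheory GRing.Theory Num.Theory.
Local Open Scope classical_set_scope.
Local Open Scope ring_scope.

Section Convexity.
Context {R : realType} {d : nat}.
Implicit Types (A : set 'rV[R]_d) (h : 'rV[R]_d -> R).

Definition conv_hull A : set 'rV[R]_d :=
  [set u | exists (N : nat) (a : 'I_N -> 'rV[R]_d) (lam : 'I_N -> R),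
    [/\ forall i, A (a i), forall i, 0 <= lam i, \sum_i lam i = 1
      & u = \sum_i lam i *: a i]].

Definition extreme_points A : set 'rV[R]_d :=
  [set u | A u /\ forall a b (t : R), A a -> A b -> 0 < t < 1 ->
    u = t *: a + (1 - t) *: b -> a = u /\ b = u].

Definition polytope A := exists2 S, finite_set S & A = conv_hull S.

Definition quasiconvex_on A h :=
  forall a b (t : R), A a -> A b -> 0 <= t <= 1 ->
    h (t *: a + (1 - t) *: b) <= Num.max (h a) (h b).

End Convexity.

Section Multiobjective.
Context {R : realType} {n p : nat}.
Implicit Types (y z : 'rV[R]_p).

Definition lev y z := forall i, y 0 i <= z 0 i.

Definition dominates y z := lev y z /\ y <> z.

(* The problem min_(x in X) g x; only the values of g on X matter. *)
Variables (X : set 'rV[R]_n) (g : 'rV[R]_n -> 'rV[R]_p).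

Definition efficient : set 'rV[R]_n :=
  [set x | X x /\ ~ exists2 x', (X `\ x) x' & dominates (g x') (g x)].

Definition nondominated : set 'rV[R]_p := g @` efficient.

Definition extreme_supported_nondominated : set 'rV[R]_p :=
  [set y | (g @` X) y /\
    ~ exists2 z, conv_hull (nondominated `\ y) z & lev z y].

Definition representative (Xs : set 'rV[R]_n) :=
  Xs `<=` X /\ g @` Xs = extreme_supported_nondominated.

Definition ideal_point_property :=
  forall i, exists2 x, X x & forall x', X x' -> g x 0 i <= g x' 0 i.

Definition domination_property :=
  forall y, (g @` X) y -> ~ nondominated y ->
    exists2 y', nondominated y' & dominates y' y.

(* Every nondominated point is weakly dominated by a convex combination of
   extreme supported ones. This holds when g takes finitely many values on X,
   but it does not follow from the two properties above: the image
   {(0, 9), (9, 0)} together with {(t, 3 - t) | 1 < t <= 2} has both, all its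
   points are nondominated, and only (0, 9), (9, 0) and (2, 1) are extreme
   supported. *)
Definition generation_property :=
  forall y, nondominated y ->
    exists2 z, conv_hull extreme_supported_nondominated z & lev z y.

End Multiobjective.

Section OptimizationPessimization.
Context {R : realType} {n m p : nat}.
Variables (X : set 'rV[R]_n) (U : set 'rV[R]_m).
Variable f : 'I_p -> 'rV[R]_n -> 'rV[R]_m -> R.

Definition worst_case (V : set 'rV[R]_m) (x : 'rV[R]_n) : 'rV[R]_p :=
  \row_i sup (f i x @` V).

Definition worst_scenarios (x : 'rV[R]_n) (i : 'I_p) : set 'rV[R]_m :=
  [set xi | U xi /\ forall xi', U xi' -> f i x xi' <= f i x xi].

(* [pess x i] is the set of answers that the pessimization step may give. *)
Variable pess : 'rV[R]_n -> 'I_p -> set 'rV[R]_m.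

(* One pass of the loop: from the scenario set V, the optimization step yields
   Xs and Ys and the pessimization step yields the scenario set V'. *)
Definition iteration V Xs Ys V' :=
  [/\ representative X (worst_case V) Xs,
      Ys = extreme_supported_nondominated X (worst_case V)
    & exists2 xi : 'rV[R]_n -> 'I_p -> 'rV[R]_m,
        forall x i, Xs x -> pess x i (xi x i)
      & V' = V `|` [set xi x i | x in Xs & i in setT]].

Definition stops V (Xs : set 'rV[R]_n) :=
  forall x, Xs x -> worst_case U x = worst_case V x.

(* Every execution from the scenario set V, whatever choices are made in the
   two steps, can be carried out, returns in at most N iterations, and returns
   a pair (Xs, Ys) that satisfies post. *)
Fixpoint returns_within (N : nat)
    (post : set 'rV[R]_n -> set 'rV[R]_p -> Prop) (V : set 'rV[R]_m) : Prop :=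
  if N is N'.+1 then
    (exists Xs Ys V', iteration V Xs Ys V') /\
    (forall Xs Ys V', iteration V Xs Ys V' ->
       (stops V Xs -> post Xs Ys) /\
       (~ stops V Xs -> returns_within N' post V'))
  else False.

End OptimizationPessimization.

(* Main.v *)
Require Import Defs.
From mathcomp Require Import all_boot all_order all_algebra finmap.
From mathcomp Require Import all_classical all_reals topology.
From mathcomp Require Import ring.
Import Order.TTheory GRing.Theory Num.Theory.
Import numFieldTopology.Exports.
Local Open Scope classical_set_scope.
Local Open Scope ring_scope.

(** Adding scenarios only increases the worst case, and at termination the two
worst-case maps g <= h (over the current scenarios, over U) agree on the
representatives. Domination below g turns a combination that refutes a point
of g being extreme supported for h into one that refutes it for g; conversely
every point of h is weakly dominated by a combination of extreme supported
points of g, all of which are extreme supported for h. If the loop does not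
stop, some worst scenario is new, so the number of missing scenarios drops.
A quasiconvex function on the hull of a finite set is maximal at an extreme
point, since the hull is generated by its extreme points: a generator that is
not extreme lies in the hull of the others. *)

(** * Counting and maximizing over finite sets *)

Lemma fset_set_card_lt {T : choiceType} (A B : set T) x :
  finite_set B -> A `<=` B -> B x -> ~ A x ->
  (#|` fset_set A| < #|` fset_set B|)%N.
Proof.
move=> Bfin AB Bx Ax; have Afin := sub_finite_set AB Bfin.
apply: fproper_ltn_card; rewrite fproperE.
apply/andP; split; first by rewrite -fset_set_sub.
by apply/negP; rewrite -fset_set_sub // => /(_ x Bx).
Qed.

Lemma finite_set_argmax {R : realType} {T : choiceType} (A : set T) (h : T -> R) :
  finite_set A -> A !=set0 -> exists2 x, A x & forall y, A y -> h y <= h x.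
Proof.
move=> Afin [a Aa]; have aA : a \in fset_set A by rewrite in_fset_set // inE.
case: (@arg_maxP _ _ _ [` aA]%fset xpredT (fun u : fset_set A => h (val u))) => // x _ xmax.
exists (val x) => [|y Ay].
  by have := valP x; rewrite in_fset_set // inE.
have yA : y \in fset_set A by rewrite in_fset_set // inE.
exact: (xmax [` yA]%fset).
Qed.

(** * Convex hulls and their extreme points *)

Section Hull.
Context {R : realType} {d : nat}.
Implicit Types (A B C S : set 'rV[R]_d) (u v : 'rV[R]_d).

Definition convex_set C := forall a b (t : R), C a -> C b -> 0 <= t <= 1 ->
  C (t *: a + (1 - t) *: b).

(* The apex is allowed even when C is empty, so that the relation is closed
   under sums with possibly zero total weight. *)
Definition cone C (L : R) v :=
  L = 0 /\ v = 0 \/ 0 < L /\ exists2 c, C c & v = L *: c.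

Lemma coneD C L1 v1 L2 v2 : convex_set C ->
  cone C L1 v1 -> cone C L2 v2 -> cone C (L1 + L2) (v1 + v2).
Proof.
move=> Ccvx [[-> ->]|[L1_gt0 [c1 Cc1 ->]]]; first by rewrite !add0r.
move=> [[-> ->]|[L2_gt0 [c2 Cc2 ->]]].
  by rewrite !addr0; right; split => //; exists c1.
have L_gt0 : 0 < L1 + L2 by rewrite addr_gt0.
have L_neq0 : L1 + L2 != 0 by rewrite gt_eqF.
right; split => //; exists ((L1 / (L1 + L2)) *: c1 + (1 - L1 / (L1 + L2)) *: c2).
  apply: Ccvx => //; rewrite divr_ge0 ?(ltW L1_gt0) ?(ltW L_gt0) //=.
  by rewrite ler_pdivrMr // mul1r lerDl ltW.
rewrite scalerDr !scalerA; congr (_ *: _ + _ *: _); field => //.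
Qed.

Lemma coneZ C (k L : R) v : 0 <= k -> cone C L v -> cone C (k * L) (k *: v).
Proof.
rewrite le_eqVlt => /predU1P[<-|k_gt0]; first by rewrite mul0r scale0r; left.
move=> [[-> ->]|[L_gt0 [c Cc ->]]]; first by rewrite mulr0 scaler0; left.
by right; split; [rewrite mulr_gt0|exists c; rewrite ?scalerA].
Qed.

Lemma cone_sum C (I : finType) (P : pred I) (a : I -> 'rV[R]_d) (lam : I -> R) :
  convex_set C -> (forall i, P i -> C (a i)) -> (forall i, P i -> 0 <= lam i) ->
  cone C (\sum_(i | P i) lam i) (\sum_(i | P i) lam i *: a i).
Proof.
move=> Ccvx Ca lam_ge0.
apply: (big_ind2 (cone C)) => [|L1 v1 L2 v2|i Pi]; first by left.
  exact: coneD.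
rewrite -{1}[lam i]mulr1; apply: coneZ; first exact: lam_ge0.
by right; split => //; exists (a i); rewrite ?scale1r; first exact: Ca.
Qed.

(** Total weight 1 excludes the apex of the cone. This serves below as the induction principle for
    hulls, with [C] the set of points having the desired property. *)
Lemma conv_hull_min A C : convex_set C -> A `<=` C -> conv_hull A `<=` C.
Proof.
move=> Ccvx AC _ [N [a [lam [Aa lam_ge0 lam1 ->]]]].
have := @cone_sum C 'I_N xpredT a lam Ccvx (fun i _ => AC _ (Aa i)) (fun i _ => lam_ge0 i).
rewrite lam1 => -[[/eqP]|[_ [c Cc ->]]]; first by rewrite oner_eq0.
by rewrite scale1r.
Qed.

Lemma sub_conv_hull A : A `<=` conv_hull A.
Proof.
move=> u Au; exists 1, (fun=> u), (fun=> 1); split => //.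
  by rewrite big_ord1.
by rewrite big_ord1 scale1r.
Qed.

Lemma convex_conv_hull A : convex_set (conv_hull A).
Proof.
move=> _ _ t [N1 [a1 [l1 [Aa1 l1_ge0 l11 ->]]]] [N2 [a2 [l2 [Aa2 l2_ge0 l21 ->]]]].
move=> /andP[t_ge0 t_le1].
exists (N1 + N2)%N.
exists (fun i => match fintype.split i with inl j => a1 j | inr j => a2 j end).
exists (fun i => match fintype.split i with
  inl j => t * l1 j | inr j => (1 - t) * l2 j end).
split => [i|i||].
- by case: fintype.split.
- by case: fintype.split => j; rewrite mulr_ge0 // subr_ge0.
- rewrite big_split_ord /=.
  under eq_bigr do rewrite (unsplitK (inl _)).
  under [X in _ + X]eq_bigr do rewrite (unsplitK (inr _)).
  by rewrite -!mulr_sumr l11 l21 !mulr1 addrC subrK.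
rewrite big_split_ord /=.
under [X in _ = X + _]eq_bigr do rewrite (unsplitK (inl _)) -scalerA.
under [X in _ = _ + X]eq_bigr do rewrite (unsplitK (inr _)) -scalerA.
by rewrite -!scaler_sumr.
Qed.

Lemma conv_hullS A B : A `<=` B -> conv_hull A `<=` conv_hull B.
Proof.
move=> AB; apply: conv_hull_min; first exact: convex_conv_hull.
by move=> u /AB; exact: sub_conv_hull.
Qed.

Lemma conv_hullK A : conv_hull (conv_hull A) = conv_hull A.
Proof.
apply/seteqP; split; last exact: sub_conv_hull.
by apply: conv_hull_min; first exact: convex_conv_hull.
Qed.

(** Removing an extreme point [u] keeps the hull convex. If [u] were not in [A], the smaller set
    would contain [A], hence the whole hull and [u] itself. *)
Lemma extreme_points_conv_hull_sub A : extreme_points (conv_hull A) `<=` A.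
Proof.
move=> u [Au uext]; apply: contrapT => NAu.
suff : (conv_hull A `\ u) u by case=> _; apply.
apply: (@conv_hull_min A) (Au); last first.
  by move=> v Av; split; [exact: sub_conv_hull|move=> vu; apply: NAu; rewrite -vu].
move=> a b t [Aa au] [Ab bu] /[dup] t01 /andP[t_ge0 t_le1].
split; first exact: convex_conv_hull.
move=> abu; have [t0|t_neq0] := eqVneq t 0.
  by apply: bu; rewrite -abu t0 scale0r subr0 scale1r add0r.
have [t1|t_neq1] := eqVneq t 1.
  by apply: au; rewrite -abu t1 subrr scale0r addr0 scale1r.
have [] := uext a b t Aa Ab => [|//|/au //].
by rewrite !lt_neqAle t_ge0 t_le1 eq_sym t_neq0 t_neq1.
Qed.

(** All weight carried by [s] is collected in [al]; the rest is a cone element because its weight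
    [1 - al] may vanish. *)
Lemma conv_hullD1 A s u : conv_hull A u ->
  exists (al : R) v, u = al *: s + v /\ cone (conv_hull (A `\ s)) (1 - al) v.
Proof.
move=> [N [a [lam [Aa lam_ge0 lam1 ->]]]].
exists (\sum_(i | a i == s) lam i), (\sum_(i | a i != s) lam i *: a i).
rewrite (bigID (fun i => a i == s)) /= scaler_suml; split.
  by congr (_ + _); apply: eq_bigr => i /eqP ->.
rewrite -lam1 (bigID (fun i => a i == s)) /= addrAC subrr add0r.
apply: cone_sum => // [|i ais]; first exact: convex_conv_hull.
by apply: sub_conv_hull; split => //; exact/eqP.
Qed.

(** Write [s] as a proper combination of two hull points and split [s] off from both. Cancelling
    leaves [L *: s] in the cone over the other generators, where [L] is the remaining weight. If
    [L > 0], then [s] is redundant; if [L = 0], both points equal [s]. *)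
Lemma extreme_or_redundant A s : A s ->
  extreme_points (conv_hull A) s \/ conv_hull (A `\ s) s.
Proof.
move=> As; have [?|NBs] := pselect (conv_hull (A `\ s) s); first by right.
left; split; first exact: sub_conv_hull.
have cone0 (al : R) v : cone (conv_hull (A `\ s)) (1 - al) v -> al = 1 -> v = 0.
  by move=> [[]//|[+ _] al1]; rewrite al1 subrr ltxx.
have cone_le (al : R) v : cone (conv_hull (A `\ s)) (1 - al) v -> al <= 1.
  by rewrite -subr_ge0; case=> [[-> _]|[/ltW]].
move=> a b t /(@conv_hullD1 _ s)[al [v [-> cv]]].
move=> /(@conv_hullD1 _ s)[be [w [-> cw]]] /andP[t_gt0 t_lt1] sE.
have t'_gt0 : 0 < 1 - t by rewrite subr_gt0.
have := coneD _ _ _ _ _ (@convex_conv_hull _)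
  (coneZ _ _ _ _ (ltW t_gt0) cv) (coneZ _ _ _ _ (ltW t'_gt0) cw).
have -> : t *: v + (1 - t) *: w = (t * (1 - al) + (1 - t) * (1 - be)) *: s.
  have -> : t * (1 - al) + (1 - t) * (1 - be) = 1 - (t * al + (1 - t) * be) by ring.
  rewrite [RHS]scalerBl scale1r {1}sE.
  by apply/matrixP => i j; rewrite !mxE; ring.
have al_le1 := cone_le _ _ cv; have be_le1 := cone_le _ _ cw.
case=> [[/eqP + _]|[L_gt0 [c Bc /(scalerI (lt0r_neq0 L_gt0)) sc]]]; last first.
  by case: NBs; rewrite [X in conv_hull _ X]sc.
rewrite paddr_eq0 ?mulr_ge0 ?subr_ge0 ?(ltW t_lt1) ?(ltW t_gt0) //.
rewrite !mulf_eq0 (gt_eqF t_gt0) (gt_eqF t'_gt0) /= !subr_eq0 => /andP[/eqP al1 /eqP be1].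
rewrite (cone0 _ _ cv) // (cone0 _ _ cw) //.
by rewrite -al1 -be1 scale1r addr0.
Qed.

Lemma conv_hull_extreme S : finite_set S ->
  conv_hull S `<=` conv_hull (extreme_points (conv_hull S)).
Proof.
(* Induction on a strict bound [k] for the number of generators: a redundant one is dropped without
   changing the hull. *)
move: {2}#|` fset_set S|.+1 (ltnSn #|` fset_set S|) => k.
elim: k S => // k IH S Sk Sfin.
have [Sext|] := pselect (S `<=` extreme_points (conv_hull S)).
  exact: conv_hullS.
rewrite -existsNE => -[s /not_implyP[Ss Nsext]].
have [//|redundant] := extreme_or_redundant _ _ Ss.
have SE : conv_hull S = conv_hull (S `\ s).
  apply/seteqP; split; last by apply: conv_hullS => ? [].
  apply: conv_hull_min; first exact: convex_conv_hull.
  move=> u Su; have [->//|us] := pselect (u = s).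
  by apply: sub_conv_hull; split.
rewrite SE; apply: IH; last exact: finite_setD.
rewrite -ltnS; apply: leq_trans Sk; rewrite ltnS.
by apply: (@fset_set_card_lt _ _ _ s) => // -[_]; apply.
Qed.

Lemma quasiconvex_max S (h : 'rV[R]_d -> R) : finite_set S -> S !=set0 ->
  quasiconvex_on (conv_hull S) h ->
  exists2 s, extreme_points (conv_hull S) s &
    forall u, conv_hull S u -> h u <= h s.
Proof.
move=> Sfin [s0 Ss0] hqc; set E := extreme_points _.
have Efin : finite_set E := sub_finite_set (@extreme_points_conv_hull_sub _) Sfin.
have SE := conv_hull_extreme _ Sfin.
have E0 : E !=set0.
  have [[|N] [a [lam [Ea _ lam1 _]]]] := SE _ (sub_conv_hull _ _ Ss0).
    by move: lam1; rewrite big_ord0 => /esym/eqP; rewrite oner_eq0.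
  by exists (a ord0); exact: Ea.
have [s Es smax] := finite_set_argmax E h Efin E0.
exists s => // u /SE Eu.
(* By quasiconvexity this sublevel set is convex, and it contains every extreme point. *)
suff [] : [set u | conv_hull S u /\ h u <= h s] u by [].
apply: conv_hull_min Eu => [a b t [Sa ha] [Sb hb] t01|e Ee].
  split; first exact: convex_conv_hull.
  by apply: le_trans (hqc _ _ _ Sa Sb t01) _; rewrite ge_max ha.
by split; [case: Ee|exact: smax].
Qed.

End Hull.

(** * Dominance and the transfer of extreme supported points *)

Section Dominance.
Context {R : realType} {n p : nat}.
Variables (X : set 'rV[R]_n).
Implicit Types (g h : 'rV[R]_n -> 'rV[R]_p) (y z : 'rV[R]_p).

Lemma lev_trans y1 y2 y3 : lev y1 y2 -> lev y2 y3 -> lev y1 y3.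
Proof. by move=> y12 y23 i; exact: le_trans (y12 i) (y23 i). Qed.

Lemma conv_hull_lev (A B : set 'rV[R]_p) :
  (forall a, A a -> exists2 b, B b & lev b a) ->
  forall z, conv_hull A z -> exists2 z', conv_hull B z' & lev z' z.
Proof.
move=> AB z Az; suff : [set z | exists2 z', conv_hull B z' & lev z' z] z by [].
apply: conv_hull_min Az => [a b t [a' Ba' aa'] [b' Bb' bb'] t01|a /AB[b Bb ba]].
  exists (t *: a' + (1 - t) *: b'); first exact: convex_conv_hull.
  move=> i; rewrite !mxE; case/andP: t01 => t_ge0 t_le1.
  by rewrite lerD // ler_wpM2l // subr_ge0.
by exists b => //; exact: sub_conv_hull.
Qed.

Lemma nondominated_sub g : nondominated X g `<=` g @` X.
Proof. by move=> _ [x [Xx _] <-]; exists x. Qed.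

(** Efficiency only speaks of solutions other than [x0], but [g x <> g x0] already forces
    [x <> x0]. *)
Lemma nondominated_lev g x y : nondominated X g y -> X x -> lev (g x) y -> g x = y.
Proof.
move=> [x0 [Xx0 x0eff] <-] Xx gx; apply: contrapT => gx_neq.
by apply: x0eff; exists x => //; split => // xx0; apply: gx_neq; rewrite xx0.
Qed.

Lemma domination_lev g y : domination_property X g -> (g @` X) y ->
  exists2 w, nondominated X g w & lev w y.
Proof.
move=> gdom gy; have [yN|yN] := pselect (nondominated X g y); first by exists y.
by have [w wN []] := gdom _ gy yN; exists w.
Qed.

Lemma extreme_supported_nondominatedW g : domination_property X g ->
  extreme_supported_nondominated X g `<=` nondominated X g.
Proof.
move=> gdom y [gy yext]; apply: contrapT => yN.
have [w wN [wy w_neq]] := gdom _ gy yN.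
by apply: yext; exists w => //; apply: sub_conv_hull; split.
Qed.

Lemma representative_relaxation g h Xs :
  domination_property X g -> domination_property X h ->
  generation_property X g ->
  (forall x, X x -> lev (g x) (h x)) -> (forall x, Xs x -> h x = g x) ->
  representative X g Xs -> representative X h Xs.
Proof.
move=> gdom hdom ggen gh hg [XsX XsE].
(* It remains to show that [g] and [h] have the same extreme supported points. *)
have hXs : h @` Xs = extreme_supported_nondominated X g.
  by rewrite -XsE; apply: eq_imagel.
split=> //; rewrite hXs.
have ESN_sub : extreme_supported_nondominated X g `<=`
    extreme_supported_nondominated X h.
  move=> y /[dup] yESN; rewrite -{1}hXs => -[x Xsx xy]; have Xx := XsX _ Xsx.
  split; first by exists x.
  move=> [z zN zy]; case: yESN => _; apply.
  suff [z' z'N z'z] : exists2 z', conv_hull (nondominated X g `\ y) z' & lev z' z.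
    by exists z' => //; exact: lev_trans zy.
  apply: conv_hull_lev zN => a [aN ay]; have [x' Xx' x'a] := nondominated_sub _ _ aN.
  have [|w wN wx'] := @domination_lev g (g x') gdom; first by exists x'.
  have wh := lev_trans _ _ _ wx' (gh _ Xx').
  (* If [w] were [y], then [h x = y] would lie weakly below [a], which is nondominated for [h], so
     [a = y]. *)
  rewrite x'a in wh; exists w => //; split => // wy; apply: ay.
  by rewrite -xy; apply/esym/(nondominated_lev _ _ _ aN Xx); rewrite xy -wy.
apply/seteqP; split => // y yESN; apply: contrapT => Ny.
have [x Xx xy] := nondominated_sub _ _ (extreme_supported_nondominatedW _ hdom _ yESN).
have [|w wN wx] := @domination_lev g (g x) gdom; first by exists x.
(* The chain [z], [w], [g x], [h x = y] is increasing. As [y] is assumed not extreme supported for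
   [g], all points combined in [z] differ from [y], so [z] refutes [y] for [h]. *)
have [z zE zw] := ggen _ wN.
case: yESN => _; apply; exists z.
  apply: conv_hullS zE => e eE; split; last by move=> ey; apply: Ny; rewrite -ey.
  exact/extreme_supported_nondominatedW/ESN_sub.
by rewrite -xy; apply: lev_trans (gh _ Xx); exact: lev_trans wx.
Qed.

Lemma representative_exists g : exists Xs, representative X g Xs.
Proof.
exists [set x | X x /\ extreme_supported_nondominated X g (g x)].
split=> [x []//|]; apply/seteqP; split => [_ [x [_ ?] <-]//|y yE].
by have [[x Xx xy] _] := yE; exists x => //; split; rewrite ?xy.
Qed.

End Dominance.

(** * Correctness and termination of the loop *)

Section Loop.
Context {R : realType} {n m p : nat}.
Variables (X : set 'rV[R]_n) (U : set 'rV[R]_m).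
Variable f : 'I_p -> 'rV[R]_n -> 'rV[R]_m -> R.
Hypothesis f_sup : forall x i, X x -> has_ubound (f i x @` U).

Lemma worst_case_lev V W x : X x -> V !=set0 -> V `<=` W -> W `<=` U ->
  lev (worst_case f V x) (worst_case f W x).
Proof.
move=> Xx [v Vv] VW WU i; rewrite !mxE; apply: ge_sup; first by exists (f i x v), v.
move=> _ [xi Vxi <-]; apply: ub_le_sup; last by exists xi => //; exact: VW.
by apply: subset_has_ubound (f_sup x i Xx); exact: image_subset.
Qed.

Lemma worst_case_worst V x (xi : 'I_p -> 'rV[R]_m) : X x -> V `<=` U ->
  (forall i, (worst_scenarios U f x i `&` V) (xi i)) ->
  worst_case f U x = worst_case f V x.
Proof.
(* If [V] is empty, the hypothesis leaves no index [i], and both rows are empty. *)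
move=> Xx VU xiV; have [V0|/set0P V0] := eqVneq V set0.
  apply/rowP => i; have [_] := xiV i; by rewrite V0.
apply/rowP => i; apply/le_anti; rewrite (worst_case_lev V U) // andbT !mxE.
have [[Uxi ximax] Vxi] := xiV i.
apply: (@le_trans _ _ (f i x (xi i))).
  by apply: ge_sup => [|_ [xi' Uxi' <-]]; [exists (f i x (xi i)), (xi i)|exact: ximax].
apply: ub_le_sup; last by exists (xi i).
by apply: subset_has_ubound (f_sup x i Xx); exact: image_subset.
Qed.

Hypothesis dom_U : domination_property X (worst_case f U).
Hypothesis dom_fin : forall V, finite_set V -> V !=set0 -> V `<=` U ->
  domination_property X (worst_case f V).
Hypothesis gen_fin : forall V, finite_set V -> V !=set0 -> V `<=` U ->
  generation_property X (worst_case f V).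

(** A finite pool containing all pessimization answers: [U] in part (i), the extreme points in part
    (ii). *)
Variable E : set 'rV[R]_m.
Hypotheses (E_fin : finite_set E) (EU : E `<=` U).
Variable pess : 'rV[R]_n -> 'I_p -> set 'rV[R]_m.
Hypothesis pess_sub : forall x i, pess x i `<=` worst_scenarios U f x i `&` E.
Hypothesis pess_neq0 : forall x i, X x -> pess x i !=set0.

(** The scenarios of [E] missing from [V] bound the passes that do not stop. The inequality is
    strict because one pass is needed even when none is missing. *)
Lemma returns_within_card N V : finite_set V -> V !=set0 -> V `<=` U ->
  (#|` fset_set (E `\` V)| < N)%N ->
  returns_within X U f pess N
    (fun Xs _ => representative X (worst_case f U) Xs) V.
Proof.
elim: N V => // N IH V Vfin V0 VU VN; split.
  have [Xs XsR] := @representative_exists R n p X (worst_case f V).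
  have [xi xiP] : {xi : 'rV[R]_n -> 'I_p -> 'rV[R]_m &
      forall x i, X x -> pess x i (xi x i)}.
    have [|xi xiP] := @choice ('rV[R]_n * 'I_p) 'rV[R]_m
        (fun xi v => X xi.1 -> pess xi.1 xi.2 v).
      (* The value 0 is a dummy outside [X], where no answer is required. *)
      move=> [x i] /=; have [Xx|NXx] := pselect (X x); last by exists 0.
      by have [v pv] := pess_neq0 x i Xx; exists v.
    by exists (fun x i => xi (x, i)) => x i Xx; exact: (xiP (x, i)).
  do 3 eexists; split; [exact: XsR|reflexivity|exists xi; last reflexivity].
  by move=> x i Xsx; apply: xiP; exact: XsR.1.
move=> Xs Ys V' [XsR _ [xi xiP V'E]]; have XsX := XsR.1.
have xiE x i : Xs x -> (worst_scenarios U f x i `&` E) (xi x i).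
  by move=> Xsx; exact/pess_sub/xiP.
split=> [stop|Nstop].
  apply: (@representative_relaxation _ _ _ _ (worst_case f V)) => //.
  - exact: dom_fin.
  - exact: gen_fin.
  - by move=> x Xx; exact: worst_case_lev.
have newE : [set xi x i | x in Xs & i in setT] `<=` E.
  by move=> _ [x Xsx [i _ <-]]; case: (xiE x i Xsx).
have V'sub : V `<=` V' by rewrite V'E; left.
apply: IH.
- by rewrite V'E finite_setU; split => //; exact: sub_finite_set newE E_fin.
- by case: V0 => v /V'sub; exists v.
- by rewrite V'E => v [/VU//|/newE/EU].
rewrite -ltnS; apply: leq_trans VN; rewrite ltnS.
(* If every answer were already in [V], the worst cases would agree and the loop would stop. *)
have [x [i [Xsx NV]]] : exists x i, Xs x /\ ~ V (xi x i).
  apply: contrapT => H; apply: Nstop => x Xsx.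
  apply: (worst_case_worst _ _ (xi x)) => // [|i]; first exact: XsX.
  split; first by case: (xiE x i Xsx).
  by apply: contrapT => NV; apply: H; exists x, i.
apply: (@fset_set_card_lt _ _ _ (xi x i)).
- exact: finite_setD.
- by move=> v [Ev NV'v]; split => // /V'sub.
- by split => //; case: (xiE x i Xsx).
by move=> [_]; apply; rewrite V'E; right; exists x => //; exists i.
Qed.

End Loop.

(** * Iteration bounds for finite and polyhedral uncertainty *)

Theorem lemma15 (R : realType) (n m p : nat)
    (X : set 'rV[R]_n) (U : set 'rV[R]_m)
    (f : 'I_p -> 'rV[R]_n -> 'rV[R]_m -> R)
    (f_sup : forall x i, X x -> has_ubound (f i x @` U))
    (dom_U : domination_property X (worst_case f U))
    (ideal_U : ideal_point_property X (worst_case f U))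
    (dom_fin : forall V, finite_set V -> V !=set0 -> V `<=` U ->
       domination_property X (worst_case f V))
    (ideal_fin : forall V, finite_set V -> V !=set0 -> V `<=` U ->
       ideal_point_property X (worst_case f V))
    (gen_fin : forall V, finite_set V -> V !=set0 -> V `<=` U ->
       generation_property X (worst_case f V))
    (U0 : set 'rV[R]_m)
    (U0_fin : finite_set U0) (U0_neq0 : U0 !=set0) (U0_sub : U0 `<=` U) :
  let post := fun (Xs : set 'rV[R]_n) (_ : set 'rV[R]_p) =>
    representative X (worst_case f U) Xs in
  (finite_set U ->
     returns_within X U f (worst_scenarios U f) #|` fset_set U| post U0) /\
  (polytope U \/ finite_set U ->
   (forall x i, X x -> {within conv_hull U, continuous (f i x)}) ->
   (forall x i, X x -> quasiconvex_on (conv_hull U) (f i x)) ->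
   let E := extreme_points (conv_hull U) in
   let pess := fun x i => worst_scenarios U f x i `&` E in
   let K := #|` fset_set E| in
   (U0 `&` E !=set0 -> returns_within X U f pess K post U0) /\
   returns_within X U f pess K.+1 post U0).
Proof.
move=> post; have [u0 U0u0] := U0_neq0; have Uu0 := U0_sub _ U0u0; split.
  move=> Ufin; apply: (@returns_within_card _ _ _ _ _ _ _ f_sup dom_U dom_fin gen_fin U) => //.
  - by move=> x i v vworst; split => //; exact: vworst.1.
  - move=> x i _; have [|v Uv vmax] := finite_set_argmax U (f i x) Ufin; first by exists u0.
    by exists v; split.
  (* The initial scenario [u0] is not missing, so fewer than [|U|] scenarios are. *)
  by apply: (@fset_set_card_lt _ _ _ u0) => // -[_]; apply.
move=> Upoly _ fqc E pess K.
have [S [Sfin SU UE]] : exists S, [/\ finite_set S, S `<=` U & conv_hull U = conv_hull S].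
  case: Upoly => [[S Sfin ->]|Ufin]; last by exists U; split.
  by exists S; split; rewrite ?conv_hullK //; exact: sub_conv_hull.
have ES : E `<=` S by rewrite /E UE; exact: extreme_points_conv_hull_sub.
have Efin : finite_set E := sub_finite_set ES Sfin.
have S0 : S !=set0.
  have := @sub_conv_hull _ _ _ _ Uu0; rewrite UE => -[[|N] [a [lam [Sa _ lam1 _]]]].
    by move: lam1; rewrite big_ord0 => /esym/eqP; rewrite oner_eq0.
  by exists (a ord0); exact: Sa.
have pess_neq0 x i : X x -> pess x i !=set0.
  move=> Xx; have fxqc := fqc x i Xx; rewrite UE in fxqc.
  (* The maximizer over the hull is one of the generators, hence in [U], and so is a worst scenario
     there. *)
  have [s Es smax] := quasiconvex_max S (f i x) Sfin S0 fxqc.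
  have Es' : E s by rewrite /E UE.
  exists s; split => //; split => [|u Uu]; first exact/SU/ES.
  by apply: smax; rewrite -UE; exact: sub_conv_hull.
have run := @returns_within_card _ _ _ _ _ _ _ f_sup dom_U dom_fin gen_fin E Efin
  (subset_trans ES SU) pess (fun _ _ => @subset_refl _ _) pess_neq0.
(* An initial extreme point leaves fewer than [K] missing; otherwise all [K] may be, which gives
   [K.+1]. *)
split=> [[e [U0e Ee]]|]; apply: run => //.
  by apply: (@fset_set_card_lt _ _ _ e) => // -[_]; apply.
rewrite ltnS; apply: fsubset_leq_card.
by rewrite -fset_set_sub; [move=> v []|exact: finite_setD|].
Qed.
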